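(* For any graph $G$, $\operatorname{N}(G)\leq \operatorname{T}(G)\leq \operatorname{Z}(G)$.
   Context: Graphs are finite and simple. A real $n\times n$ matrix $A=[a_{ij}]$ is combinatorially symmetric if $a_{ij}\neq 0$ if and only if $a_{ji}\neq 0$. The graph of such an $A$ has vertex set $\{1,\dots,n\}$ and edges $\{ij : i\neq j,\ a_{ij}\neq 0\}$ (the diagonal entries are unrestricted). $\operatorname{N}(G)$ is the maximum nullity (dimension of the null space) among all real combinatorially symmetric matrices whose graph is $G$. A fort in $G$ is a nonempty subset $F \subseteq V(G)$ such that no vertex $v \in V(G)\setminus F$ has exactly one neighbor in $F$; $\mathsf{Fort}(G)$ is the collection of all forts of $G$. A collection $\mathcal{F}\subseteq\mathsf{Fort}(G)$ is compatible if for any distinct $F_1,F_2\in\mathcal{F}$ and any $x\in F_1\cap F_2$ there exists $F\in\mathcal{F}$ with $F\subseteq (F_1\cup F_2)\setminus\{x\}$. The transversal number of a collection $\mathcal{S}$ of subsets of $V(G)$ is $\tau(\mathcal{S})=\min\{|T| : T\subseteq V(G),\ T\cap S\neq\emptyset\text{ for all }S\in\mathcal{S}\}$. The fort transversal number of $G$ is $\operatorname{T}(G)=\max\{\tau(\mathcal{F}) : \mathcal{F}\subseteq\mathsf{Fort}(G),\ \mathcal{F}\text{ compatible}\}$. Standard zero forcing: each vertex of $G$ is initially either filled or unfilled; the color change rule is to change an unfilled vertex $w$ to filled if $w$ is the unique unfilled neighbor of some filled vertex $v$. A set $B\subseteq V(G)$ is a standard zero forcing set if, starting with exactly the vertices of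 $B$ filled and applying the rule repeatedly, all vertices of $G$ eventually become filled. $\operatorname{Z}(G)=\min\{|B| : B\text{ is a standard zero forcing set of }G\}$. *)

(* Defs.v *)
From HB Require Import structures.
From mathcomp Require Import all_boot all_order all_algebra.
From mathcomp Require Import boolp reals.

Set Implicit Arguments.
Unset Strict Implicit.
Unset Printing Implicit Defensive.

Import GRing.Theory.

Record sgraph := SGraph {
  vertex :> finType;
  adj : rel vertex;
  adj_sym : symmetric adj;
  adj_irrefl : irreflexive adj }.

Definition neighbors (G : sgraph) (v : G) : {set G} := [set u | adj v u].

Section MaxNullity.
Local Open Scope ring_scope.

Definition comb_symmetric (F : fieldType) (n : nat) (A : 'M[F]_n) : Prop :=
  forall i j, (A i j != 0) = (A j i != 0).

Definition mx_adj (F : fieldType) (n : nat) (A : 'M[F]_n) : rel 'I_n :=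
  [rel i j | (i != j) && (A i j != 0)].

(* The vertices of G index the rows and columns through the fixed bijection
   enum_rank : G -> 'I_#|G|. *)
Definition has_graph (F : fieldType) (G : sgraph) (A : 'M[F]_#|G|) : Prop :=
  forall x y : G, mx_adj A (enum_rank x) (enum_rank y) = adj x y.

(* kermx is the left kernel, so the null space {x | A x = 0} is, up to
   transposition, the row space of kermx A^T. *)
Definition nullity (F : fieldType) (n : nat) (A : 'M[F]_n) : nat :=
  \rank (kermx A^T).

Definition is_nullity (F : fieldType) (G : sgraph) (k : nat) : Prop :=
  exists A : 'M[F]_#|G|, [/\ comb_symmetric A, has_graph A & nullity A = k].

(* The bound k <= #|G| loses nothing; see max_nullity_attained and
   max_nullity_ub. *)
Definition max_nullity (F : fieldType) (G : sgraph) : nat :=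
  (\max_(k < #|G|.+1 | `[< is_nullity F G k >]) k)%N.

Lemma nullity_le (F : fieldType) (n : nat) (A : 'M[F]_n) : (nullity A <= n)%N.
Proof. exact: rank_leq_row. Qed.

Lemma max_nullity_ub (F : fieldType) (G : sgraph) (A : 'M[F]_#|G|) :
  comb_symmetric A -> has_graph A -> (nullity A <= max_nullity F G)%N.
Proof.
move=> sA gA; have ltA : (nullity A < #|G|.+1)%N by rewrite ltnS nullity_le.
apply: (@leq_bigmax_cond _ _ (fun k : 'I_#|G|.+1 => k : nat) (Ordinal ltA)).
by apply/asboolP; exists A.
Qed.

Lemma max_nullity_attained (F : fieldType) (G : sgraph) :
  is_nullity F G (max_nullity F G).
Proof.
pose A : 'M[F]_#|G| := \matrix_(i, j) (adj (enum_val i) (enum_val j))%:R.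
have A0 i j : (A i j != 0) = adj (enum_val i) (enum_val j).
  by rewrite mxE; case: adj; rewrite ?oner_eq0 ?eqxx.
have isA : is_nullity F G (nullity A).
  exists A; split => //; first by move=> i j; rewrite !A0 adj_sym.
  move=> x y; rewrite /mx_adj /= A0 !enum_rankK (inj_eq enum_rank_inj).
  by case: eqVneq => //= ->; rewrite adj_irrefl.
have ltA : (nullity A < #|G|.+1)%N by rewrite ltnS nullity_le.
rewrite /max_nullity (bigmax_eq_arg (Ordinal ltA)); last exact/asboolP.
by case: arg_maxnP => [|k /asboolP]; first exact/asboolP.
Qed.

End MaxNullity.

Section Forts.
Variable G : sgraph.

Definition fort (F : {set G}) : bool :=
  (F != set0) && [forall v in ~: F, #|neighbors v :&: F| != 1].

Definition Fort : {set {set G}} := [set F | fort F].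

Definition compatible (S : {set {set G}}) : bool :=
  [forall F1 in S, forall F2 in S, (F1 != F2) ==>
     [forall x in F1 :&: F2,
        [exists F in S, F \subset (F1 :|: F2) :\ x]]].

Definition transversal_of (S : {set {set G}}) (T : {set G}) : bool :=
  [forall X in S, T :&: X != set0].

(* The whole vertex set is a transversal as soon as set0 \notin S, which is the
   case for collections of forts; [arg min] is meaningful only then. *)
Definition transversal_number (S : {set {set G}}) : nat :=
  #|[arg min_(T < [set: G] | transversal_of S T) #|T| ]|.

Lemma transversal_setT (S : {set {set G}}) :
  S \subset Fort -> transversal_of S [set: G].
Proof.
move=> /subsetP sS; apply/forall_inP => X /sS; rewrite inE setTI.
by case/andP.
Qed.

Definition fort_transversal_number : nat :=
  \max_(S : {set {set G}} | (S \subset Fort) && compatible S)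
     transversal_number S.

End Forts.

Section ZeroForcing.
Variable G : sgraph.

Definition force (B C : {set G}) : bool :=
  [exists v in B, exists w,
     (neighbors v :\: B == [set w]) && (C == w |: B)].

Definition zero_forcing_set (B : {set G}) : bool :=
  connect force B [set: G].

Definition zero_forcing_number : nat :=
  #|[arg min_(B < [set: G] | zero_forcing_set B) #|B| ]|.

Lemma zero_forcing_setT : zero_forcing_set [set: G].
Proof. exact: connect0. Qed.

End ZeroForcing.

(* Main.v *)
Require Import Defs.
From mathcomp Require Import all_boot all_order all_algebra.
From mathcomp Require Import boolp reals.

(** For the lower bound, let [A] be a matrix with graph [G] and take the family of
the supports of all nonzero null vectors of [A]. Row [v] of [A x = 0] says that
[v], when outside the support of [x], cannot have a single neighbor in it, so
supports are forts ([null_support_fort]). Given two null vectors that are both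
nonzero at [z], a suitable combination is a null vector that vanishes at [z],
and it is nonzero because proportional vectors have equal supports; hence the
family is compatible ([null_supports_compatible]), with no passage to minimal
supports. Finally, vanishing on a set [T] imposes [#|T|] linear conditions, so
if [#|T|] is less than the nullity, then some nonzero null vector has a support
that misses [T] ([nullity_le_transversal]).

For the upper bound, a fort that is disjoint from the filled set stays so under
forcing ([force_fort_disjoint]); a zero forcing set therefore meets every fort,
and is a transversal of any family of forts. *)

Import GRing.Theory.

Section NullSupports.
Local Open Scope ring_scope.
Variables (F : fieldType) (G : sgraph) (A : 'M[F]_#|G|).

Definition support (x : 'rV[F]_#|G|) : {set G} :=
  [set v | x 0 (enum_rank v) != 0].

Definition null_supports : {set {set G}} :=
  [set X | `[< exists x : 'rV[F]_#|G|,
                 [/\ x *m A^T = 0, x != 0 & X = support x] >]].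

Lemma null_supportsP X :
  reflect (exists x : 'rV[F]_#|G|, [/\ x *m A^T = 0, x != 0 & X = support x])
          (X \in null_supports).
Proof. by rewrite inE; exact: asboolP. Qed.

Lemma support_neq0 (x : 'rV[F]_#|G|) : x != 0 -> support x != set0.
Proof.
move=> /rV0Pn [j xj]; apply/set0Pn; exists (enum_val j).
by rewrite inE enum_valK.
Qed.

Lemma null_row (x : 'rV[F]_#|G|) (v : G) :
  x *m A^T = 0 ->
  \sum_(u : G) x 0 (enum_rank u) * A (enum_rank v) (enum_rank u) = 0.
Proof.
move=> /matrixP /(_ 0 (enum_rank v)); rewrite !mxE.
rewrite (reindex (@enum_rank G)) /=; last exact/onW_bij/enum_rank_bij.
by move=> xAv; rewrite -[RHS]xAv; apply: eq_bigr => u _; rewrite mxE.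
Qed.

Lemma null_support_fort (x : 'rV[F]_#|G|) :
  has_graph A -> x *m A^T = 0 -> x != 0 -> fort (support x).
Proof.
move=> gA xA x0; rewrite /fort support_neq0 //=.
apply/forall_inP => v; rewrite !inE negbK => /eqP xv.
apply/negP => /cards1P [w nb].
have nbE u : adj v u && (x 0 (enum_rank u) != 0) = (u == w).
  by have /setP /(_ u) := nb; rewrite !inE.
have /andP [vw xw] : adj v w && (x 0 (enum_rank w) != 0) by rewrite nbE.
have := null_row x v xA; rewrite (bigD1 w) //= big1 ?addr0 => [/eqP|u uw].
  rewrite mulf_eq0 (negPf xw) /= => /negPn.
  by have := gA v w; rewrite vw /mx_adj /= => /andP [_ ->].
apply/eqP; rewrite mulf_eq0; apply/negPn/negP; rewrite negb_or => /andP [xu Avu].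
have /negP := uw; apply; rewrite -nbE xu andbT -gA /mx_adj /= Avu andbT.
(* the diagonal entry does not contribute, as x vanishes at v *)
by rewrite (inj_eq enum_rank_inj); apply: contraNneq xu => <-; rewrite xv.
Qed.

(** Eliminating the coordinate [z] from two null vectors as in Gaussian
elimination. *)
Lemma null_supports_compatible : compatible null_supports.
Proof.
apply/forall_inP => X /null_supportsP [x [xA x0 ->]].
apply/forall_inP => Y /null_supportsP [y [yA y0 ->]].
apply/implyP => neq; apply/forall_inP => z; rewrite !inE => /andP [xz yz].
pose w := y 0 (enum_rank z) *: x - x 0 (enum_rank z) *: y.
have wE u : w 0 u = y 0 (enum_rank z) * x 0 u - x 0 (enum_rank z) * y 0 u.
  by rewrite !mxE.
apply/exists_inP; exists (support w).
  apply/null_supportsP; exists w; split => //.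
    by rewrite mulmxBl -!scalemxAl xA yA !scaler0 subrr.
  apply: contraNneq neq => w0; apply/eqP/setP => u; rewrite !inE.
  have /eqP := wE (enum_rank u); rewrite w0 mxE eq_sym subr_eq0 => /eqP prop.
  have := congr1 (eq_op^~ 0) prop.
  by rewrite !mulf_eq0 (negPf xz) (negPf yz) /= => ->.
apply/subsetP => u; rewrite !inE wE => wu; apply/andP; split.
  by apply: contraNneq wu => ->; rewrite mulrC subrr.
apply: contraR wu; rewrite negb_or !negbK => /andP [/eqP -> /eqP ->].
by rewrite !mulr0 subrr.
Qed.

Lemma nullity_le_transversal (T : {set G}) :
  transversal_of null_supports T -> (nullity A <= #|T|)%N.
Proof.
move=> /forall_inP trT; rewrite leqNgt; apply/negP => ltT.
set K := row_base (kermx A^T).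
(* a combination u *m K of the basis of null vectors K vanishes on T exactly
   when u is in the left kernel of C, which has fewer columns than rows *)
pose C : 'M_(_, #|T|) := \matrix_(i, j) K i (enum_rank (enum_val j)).
have /rowV0Pn [u /sub_kermxP uC u0] : kermx C != 0.
  rewrite kermx_eq0 /row_free neq_ltn.
  by rewrite (leq_ltn_trans (rank_leq_col C) ltT).
have xA : u *m K *m A^T = 0.
  by apply/sub_kermxP; rewrite (submx_trans (submxMl _ _)) // eq_row_base.
have x0 : u *m K != 0.
  by rewrite mulmx_free_eq0 // row_base_free.
have /trT /set0Pn [v] : support (u *m K) \in null_supports.
  by apply/null_supportsP; exists (u *m K).
rewrite !inE => /andP [vT /negP []]; apply/eqP.
have /matrixP /(_ 0 (enum_rank_in vT v)) := uC; rewrite !mxE => uCv.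
rewrite -[RHS]uCv; apply: eq_bigr => i _.
by rewrite [C _ _]mxE enum_rankK_in.
Qed.

Lemma nullity_le_fort_transversal_number :
  has_graph A -> (nullity A <= fort_transversal_number G)%N.
Proof.
move=> gA.
have sub : null_supports \subset Fort G.
  apply/subsetP => X /null_supportsP [x [xA x0 ->]].
  by rewrite inE null_support_fort.
apply: (@leq_trans (transversal_number null_supports)); last first.
  apply: (leq_bigmax_cond null_supports).
  by rewrite sub null_supports_compatible.
rewrite /transversal_number; case: arg_minnP; first exact: transversal_setT.
by move=> T trT _; apply: nullity_le_transversal.
Qed.

End NullSupports.

Section ForcingMeetsForts.
Variable G : sgraph.
Implicit Types B C X : {set G}.

(** The vertex [v] that forces is filled, hence outside the fort [X]. If the
newly filled vertex [w] were in [X], it would be the only neighbor of [v] in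
[X], because all of [X] is unfilled. *)
Lemma force_fort_disjoint X B C :
  fort X -> force B C -> [disjoint B & X] -> [disjoint C & X].
Proof.
move=> /andP [_ /forall_inP fX] /exists_inP [v vB /existsP [w]].
move=> /andP [/eqP nb /eqP ->] dBX.
rewrite -setI_eq0 setIUl setU_eq0 !setI_eq0 dBX andbT disjoints1.
have vX : v \in ~: X by rewrite inE (disjointFr dBX vB).
apply: contra (fX v vX) => wX; apply/cards1P; exists w.
apply/setP => u; rewrite in_setI; apply/andP/idP => [[vu uX]|].
  by rewrite -nb inE vu (disjointFl dBX uX).
rewrite inE => /eqP ->; split=> //.
by have := set11 w; rewrite -nb inE => /andP [].
Qed.

Lemma zero_forcing_meets_fort B X :
  zero_forcing_set B -> fort X -> B :&: X != set0.
Proof.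
move=> /connectP [p]; elim: p B => [|C p IHp] B /=.
  by move=> _ <- /andP [X0 _]; rewrite setTI.
move=> /andP [BC pC] eT fX; rewrite setI_eq0.
apply: contra (IHp C pC eT fX); rewrite setI_eq0.
exact: force_fort_disjoint.
Qed.

Lemma fort_transversal_number_le_zero_forcing :
  fort_transversal_number G <= zero_forcing_number G.
Proof.
apply/bigmax_leqP => S /andP [sS _]; rewrite /zero_forcing_number.
case: arg_minnP => [|B zB _]; first exact: zero_forcing_setT.
rewrite /transversal_number; case: arg_minnP; first exact: transversal_setT.
move=> T _; apply; apply/forall_inP => X /(subsetP sS); rewrite inE.
exact: zero_forcing_meets_fort.
Qed.

End ForcingMeetsForts.

Theorem theorem4p2 (R : realType) (G : sgraph) :
  (max_nullity R G <= fort_transversal_number G)%N /\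
  (fort_transversal_number G <= zero_forcing_number G)%N.
Proof.
split; last exact: fort_transversal_number_le_zero_forcing.
have [A [_ gA <-]] := max_nullity_attained R G.
exact: nullity_le_fort_transversal_number.
Qed.
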